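(* Let $\mathsf{X}$ be a totally ordered set with a $\sigma$-field $\mathcal X$ containing the sets $(-\infty,a]$, and let $P$ be a stochastically monotone Markov kernel on $\mathsf{X}$. Suppose that for $C=(-\infty,x_0]$ there exist $\epsilon>0$ and a probability measure $\nu$ with $P(x,\cdot)\geq\epsilon\nu(\cdot)$ for all $x\in C$; let $Q$ be the residual kernel ($Q(x,A)=(1-\epsilon)^{-1}(P(x,A)-\epsilon\nu(A))$ if $0<\epsilon<1$, $Q=\nu$ if $\epsilon=1$). Assume there exist $W_0:\mathsf{X}\to[1,\infty)$ and $\phi\in\mathcal{C}$ such that $PW_0(x)\leq W_0(x)-\phi(W_0(x))$ for $x\notin C$ and $\sup_C PW_0<\infty$. Let $r=r_\phi$, $v_0=\phi\circ W_0$, $\sigma_C=\inf\{n\geq0:X_n\in C\}$, $U_0(x)=\mathbb{E}_x\big[\sum_{k=0}^{\sigma_C}r(k)\big]$ and $V_0(x)=\mathbb{E}_x\big[\sum_{k=0}^{\sigma_C}v_0(X_k)\big]$. Then $U_0$, $V_0$ are finite everywhere, $b_{U_0}:=\sup_CQU_0<\infty$, $b_{V_0}:=\sup_CQV_0<\infty$, and $$U_0(x)\leq 1+\frac{r_\phi(1)}{\phi(1)}\{W_0(x)-1\}\mathbb{1}_{C^c}(x),\qquad V_0(x)\leq\sup_C\phi\circ W_0+W_0(x)\mathbb{1}_{C^c}(x),$$ $$b_{U_0}\leq 1+\frac{r_\phi(1)}{\phi(1)}\Big((1-\epsilon)^{-1}\Big\{\sup_CPW_0-\epsilon\nu(W_0)\Big\}-1\Big),\qquad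 b_{V_0}\leq\sup_C\phi\circ W_0+(1-\epsilon)^{-1}\Big\{\sup_CPW_0-\epsilon\nu(W_0)\Big\}.$$
   Context: Stochastically monotone: $x\mapsto P(x,(-\infty,a])$ is non-increasing for every $a$. $\mathbb{E}_x$ is expectation for the chain with kernel $P$ started at $x$. $\mathcal{C}$ is the set of functions $\phi:[1,\infty)\to\mathbb{R}^+$ that are concave and differentiable with $\phi(1)>0$, $\lim_{v\to\infty}\phi(v)=\infty$, $\lim_{v\to\infty}\phi'(v)=0$. For $\phi\in\mathcal C$, $H_\phi(v)=\int_1^v dx/\phi(x)$, $H_\phi^{-1}$ its inverse on $[0,\infty)$, and $r_\phi(n)=\phi(H_\phi^{-1}(n))/\phi(H_\phi^{-1}(0))$.
   Formalization: For ε=1, where (1−ε)^{-1}{sup_C PW_0−εν(W_0)} is the undefined 0/0, it is read as ν(W_0); the expectations defining U_0 and V_0 are written as sums over k of iterated integrals of P killed on C. *)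

(* Defs.v *)
From HB Require Import structures.
From mathcomp Require Import all_boot all_order all_algebra.
From mathcomp Require Import all_classical all_reals all_analysis.
Set Implicit Arguments. Unset Strict Implicit. Unset Printing Implicit Defensive.
Import Order.TTheory GRing.Theory Num.Theory.
Import numFieldNormedType.Exports.
Local Open Scope classical_set_scope.
Local Open Scope ring_scope.

Definition in_class_C (R : realType) (phi : R -> R) : Prop :=
  [/\ (forall v, 1 <= v -> 0 <= phi v),
      (forall x y t, 1 <= x -> 1 <= y -> 0 <= t -> t <= 1 ->
          t * phi x + (1 - t) * phi y <= phi (t * x + (1 - t) * y)),
      (forall v, 1 <= v -> derivable phi v 1),
      0 < phi 1 &
      (phi x @[x --> +oo] --> +oo) /\ (derive1 phi x @[x --> +oo] --> 0)].

Definition H_phi (R : realType) (phi : R -> R) (v : R) : R :=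
  Rintegral lebesgue_measure `[1, v] (fun x => (phi x)^-1).

Definition H_phi_inv (R : realType) (phi : R -> R) (t : R) : R :=
  xget 1 [set v | 1 <= v /\ H_phi phi v = t].

Definition r_phi (R : realType) (phi : R -> R) (n : nat) : R :=
  phi (H_phi_inv phi n%:R) / phi (H_phi_inv phi 0).

Local Open Scope ereal_scope.

(** Killed iterates: killed_iter P C g k x
      = E_x[ 1{X_0 \notin C, ..., X_(k-1) \notin C} g(X_k) ]
      = E_x[ 1{sigma_C >= k} g(X_k) ]
    for the chain with kernel P, sigma_C = inf{n >= 0 : X_n \in C}. *)
Fixpoint killed_iter d (T : measurableType d) (R : realType)
    (P : R.-pker T ~> T) (C : set T) (g : T -> \bar R) (k : nat) : T -> \bar R :=
  match k with
  | 0 => g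
  | k'.+1 => fun x => (\1_(~` C) x)%:E * \int[P x]_y killed_iter P C g k' y
  end.

(** E_x[ sum_{k=0}^{sigma_C} r(k) ] = sum_k r(k) P_x(sigma_C >= k). *)
Definition U0 d (T : measurableType d) (R : realType)
    (P : R.-pker T ~> T) (C : set T) (r : nat -> R) (x : T) : \bar R :=
  \sum_(0 <= k <oo) (r k)%:E * killed_iter P C (cst 1) k x.

(** E_x[ sum_{k=0}^{sigma_C} v(X_k) ] = sum_k E_x[ 1{sigma_C >= k} v(X_k) ]. *)
Definition V0 d (T : measurableType d) (R : realType)
    (P : R.-pker T ~> T) (C : set T) (v : T -> R) (x : T) : \bar R :=
  \sum_(0 <= k <oo) killed_iter P C (fun y => (v y)%:E) k x.

(* Main.v *)
(* Write [psi] for the inverse of [H_phi]; it is the flow of the differential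
   equation [psi' = phi o psi], and [r_phi n = phi (psi n) / phi 1].  Since
   [phi'] is nonincreasing, [(ln (phi o psi))' = phi' o psi] is nonincreasing, so
   the time-[k] flow map [v |-> psi (H_phi v + k)] is concave and [r_phi] is
   submultiplicative.  By Jensen in tangent-line form, the potentials
   [H_k v = (psi (H_phi v + k) - psi k) / phi 1] satisfy
   [P (H_(k+1) o W0) <= H_k o W0 - r_phi k] off [C], and a comparison argument
   bounds [U0] by [H_0 o W0].  The same argument with constant weights bounds [V0]
   by [W0].  The bounds over [C] follow by integrating against the residual
   kernel, since [P x = (1 - eps) Q x + eps nu] as measures. *)
Require Import Defs.
From HB Require Import structures.
From mathcomp Require Import all_boot all_order all_algebra.
From mathcomp Require Import all_classical all_reals all_analysis.
From mathcomp Require Import measurable_realfun ring lra.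
Set Implicit Arguments. Unset Strict Implicit. Unset Printing Implicit Defensive.
Import Order.TTheory GRing.Theory Num.Theory.
Import numFieldNormedType.Exports.
Local Open Scope classical_set_scope.
Local Open Scope ring_scope.

(** * Functions of the class C *)

Section rate_class.
Context {R : realType} {phi : R -> R} (phiC : in_class_C phi).
Implicit Types v x y t a b : R.

(** A concave function that drops from [x] to [y] never exceeds [phi y] again, which divergence at
    infinity forbids. *)
Lemma class_C_nondecreasing x y : 1 <= x -> x <= y -> phi x <= phi y.
Proof.
case: phiC => phi0 conc _ _ [phioo _] x1 xy.
have [//|yx] := leP (phi x) (phi y).
have xy' : x < y by rewrite lt_neqAle xy andbT; apply: contraTneq yx => ->; rewrite ltxx.
(* past [y] the graph lies below the decreasing chord through [x] and [y] *)
have key z : y < z -> phi z <= phi y.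
  move=> yz.
  have zx : 0 < z - x by lra.
  have := conc z x ((y - x) / (z - x)).
  have t0 : 0 <= (y - x) / (z - x) by rewrite divr_ge0//; lra.
  have t1 : (y - x) / (z - x) <= 1 by rewrite ler_pdivrMr//; lra.
  move=> /(_ ltac:(lra) x1 t0 t1).
  have -> : (y - x) / (z - x) * z + (1 - (y - x) / (z - x)) * x = y.
    by field; lra.
  have s0 : 0 < (y - x) / (z - x) by rewrite divr_gt0//; lra.
  move: s0 t0 t1; set s := (_ / _) => s0 t0 t1 h.
  have : 0 <= (1 - s) * (phi x - phi y) by rewrite mulr_ge0; lra.
  by move=> ?; rewrite -(ler_pM2l s0); lra.
have [M [_ hM]] := (cvgryPgt _).1 phioo (phi y).
have := hM (Num.max M y + 1); have := key (Num.max M y + 1).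
rewrite !ltr_pwDr ?le_max ?lexx ?orbT// => /(_ isT) + /(_ isT).
by move=> /le_lt_trans/[apply]; rewrite ltxx.
Qed.

Lemma class_C_gt0 v : 1 <= v -> 0 < phi v.
Proof. by case: (phiC) => _ _ _ p _ v1; apply: lt_le_trans p _; exact: class_C_nondecreasing. Qed.

(** For [v > 2], the point 2 is the convex combination of [v] and 1 with weight [1 / (v - 1)] on
    [v]. Linear growth makes [H_phi] unbounded, and later dominates [phi \o W] by a multiple of
    [W]. *)
Lemma class_C_le_linear v : 1 <= v -> phi v <= phi 2 * v.
Proof.
move=> v1; have p2 : 0 < phi 2 by apply: class_C_gt0; lra.
have [v2|v2] := leP v 2.
  by apply: (le_trans (class_C_nondecreasing v1 v2)); rewrite ler_peMr// ltW.
case: (phiC) => _ conc _ p1 _.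
have w : 0 < v - 1 by lra.
have t0 : 0 <= (v - 1)^-1 by rewrite invr_ge0; lra.
have t1 : (v - 1)^-1 <= 1 by rewrite invf_le1//; lra.
have := conc v 1 (v - 1)^-1 v1 (lexx _) t0 t1.
have -> : (v - 1)^-1 * v + (1 - (v - 1)^-1) * 1 = 2 by field; lra.
have e : (v - 1) * (v - 1)^-1 = 1 by rewrite divff// gt_eqF.
move: e t0 t1; set s := _^-1 => e s0 s1 h.
have : (v - 1) * (s * phi v + (1 - s) * phi 1) <= (v - 1) * phi 2 by rewrite ler_pM2l.
have -> : (v - 1) * (s * phi v + (1 - s) * phi 1) =
  ((v - 1) * s) * phi v + (v - 1) * phi 1 - ((v - 1) * s) * phi 1 by ring.
have : 0 <= (v - 2) * phi 1 by rewrite mulr_ge0; lra.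
rewrite e; lra.
Qed.

Lemma class_C_continuous v : 1 <= v -> {for v, continuous phi}.
Proof.
by case: (phiC) => _ _ dphi _ _ v1; apply/differentiable_continuous/derivable1_diffP/dphi.
Qed.

(** By concavity the difference quotient from [x] towards [y] is at least [phi y - phi x] for every
    step [0 < h < 1]; let [h] tend to 0. *)
Lemma class_C_tangent x y : 1 <= x -> 1 <= y ->
  phi y <= phi x + derive1 phi x * (y - x).
Proof.
case: (phiC) => _ conc dphi _ _ x1 y1.
have d : derivable phi x (y - x).
  by apply: diff_derivable; apply/derivable1_diffP/dphi.
have e : 'D_(y - x) phi x = derive1 phi x * (y - x).
  rewrite deriveE; last exact/derivable1_diffP/dphi.
  rewrite diff1E; last exact/derivable1_diffP/dphi.
  exact: (mulrC (y - x) (derive1 phi x)).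
rewrite -e -lerBlDl.
have dr : (h^-1 *: (phi (h *: (y - x) + x) - phi x)) @[h --> 0^'+] --> 'D_(y - x) phi x.
  exact: cvg_dnbhs_at_right d.
apply: (cvgr_to_ge dr); near=> h.
have h0 : 0 < h by [].
have h1 : h < 1 by near: h; exact: nbhs_right_lt.
have := conc y x h y1 x1 (ltW h0) (ltW h1).
have -> : h * y + (1 - h) * x = h * (y - x) + x by ring.
move=> hc; rewrite -![_ *: _]/(_ * _) [leRHS]mulrC ler_pdivlMr//; lra.
Unshelve. all: by end_near. Qed.

(** Adding the tangent inequalities at [x] and at [y] cancels the values of [phi]. *)
Lemma class_C_derive1_nonincreasing x y : 1 <= x -> x <= y ->
  derive1 phi y <= derive1 phi x.
Proof.
move=> x1; rewrite le_eqVlt => /predU1P[->//|xy].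
have y1 : 1 <= y by lra.
have h1 := class_C_tangent x1 y1; have h2 := class_C_tangent y1 x1.
have yx : 0 < y - x by lra.
rewrite -(ler_pM2r yx); lra.
Qed.
End rate_class.

(** * The flow generated by phi *)

Section rate_flow.
Context {R : realType} {phi : R -> R} (phiC : in_class_C phi).
Implicit Types v x y t a b : R.
Let H := H_phi phi.
Let psi := H_phi_inv phi.

Let inv_phi_continuous v : 1 <= v -> {for v, continuous (fun x => (phi x)^-1)}.
Proof.
move=> v1; apply: cvgV; first by rewrite gt_eqF// class_C_gt0.
exact: class_C_continuous.
Qed.

Let inv_phi_integrable v :
  lebesgue_measure.-integrable `[1, v] (EFin \o (fun x => (phi x)^-1)).
Proof.
apply: continuous_compact_integrable; first exact: segment_compact.
apply: continuous_in_subspaceT => x; rewrite inE/= in_itv/= => /andP[x1 _].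
exact: inv_phi_continuous.
Qed.

(** The integration interval is empty or a point. This extension by 0 keeps [H_phi] monotone on the
    whole line, from which measurability of the potentials follows. *)
Lemma H_phi_le1 v : v <= 1 -> H_phi phi v = 0.
Proof.
rewrite le_eqVlt /H_phi => /predU1P[->|v1].
  by rewrite set_itv1 Rintegral_set1.
by rewrite set_itv_ge ?Rintegral_set0// -leNgt bnd_simp.
Qed.

Lemma is_derive_H_phi v : 1 < v -> is_derive v 1 (H_phi phi) (phi v)^-1.
Proof.
(* The upper endpoint [v + 1] puts [v] in the interior, as the fundamental theorem requires. *)
move=> v1; have v1' : v < v + 1 by lra.
have [d e] := continuous_FTC1_closed v1' (inv_phi_integrable _) v1
  (inv_phi_continuous (ltW v1)).
by apply: DeriveDef; [exact: d|rewrite -derive1E; exact: e].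
Qed.

Let H_within_continuous b : {within `[1, b], continuous H}.
Proof.
have [b1|b1] := leP 1 b; last first.
  by rewrite set_itv_ge ?bnd_simp -?ltNge//; exact: continuous_subspace0.
exact: (parameterized_integral_continuous b1 (inv_phi_integrable b)).
Qed.

(** Mean value theorem with the nonincreasing derivative [1 / phi]. *)
Lemma H_phi_increment x y : 1 <= x -> x <= y ->
  (y - x) / phi y <= H_phi phi y - H_phi phi x <= (y - x) / phi x.
Proof.
move=> x1 xy; have [z||z zxy ->] := @MVT_segment R H (fun z => (phi z)^-1) x y xy.
- rewrite in_itv/= => /andP[xz _]; apply: is_derive_H_phi; lra.
- apply: continuous_subspaceW (@H_within_continuous y).
  by apply: subset_itvr; rewrite bnd_simp.
move: zxy; rewrite in_itv/= => /andP[xz zy].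
have px := class_C_gt0 phiC x1.
have pz : 0 < phi z by apply: (class_C_gt0 phiC); lra.
have py : 0 < phi y by apply: (class_C_gt0 phiC); lra.
rewrite [_^-1 * _]mulrC !ler_wpM2l ?subr_ge0// lef_pV2//; apply: (class_C_nondecreasing phiC); lra.
Qed.

Lemma H_phi_lt x y : 1 <= x -> x < y -> H_phi phi x < H_phi phi y.
Proof.
move=> x1 xy; have /andP[h _] := H_phi_increment x1 (ltW xy).
rewrite -subr_gt0; apply: lt_le_trans h; rewrite divr_gt0 ?subr_gt0//.
by apply: (class_C_gt0 phiC); lra.
Qed.

Lemma H_phi_nondecreasing : nondecreasing_fun (H_phi phi).
Proof.
move=> x y; have [x1|x1] := leP x 1.
  move=> xy; rewrite (H_phi_le1 x1); have [y1|y1] := leP y 1.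
    by rewrite H_phi_le1.
  by rewrite -(H_phi_le1 (lexx 1)) ltW// H_phi_lt.
by rewrite le_eqVlt => /predU1P[->//|xy]; rewrite ltW// H_phi_lt// ltW.
Qed.

Lemma H_phi_ge0 v : 0 <= H_phi phi v.
Proof.
have [v1|v1] := leP v 1; first by rewrite H_phi_le1.
by rewrite -(H_phi_le1 (lexx 1)) H_phi_nondecreasing// ltW.
Qed.

(* [phi v <= phi 2 * v] makes each dyadic block contribute at least [(2 phi 2)^-1]. *)
Let H_phi_dyadic n : n%:R / (2 * phi 2) <= H (2 ^+ n).
Proof.
have p2 : 0 < phi 2 by apply: (class_C_gt0 phiC); lra.
elim: n => [|n IH]; first by rewrite mul0r H_phi_ge0.
have n1 : 1 <= 2 ^+ n :> R by rewrite exprn_ege1//; lra.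
have n2 : 2 ^+ n <= 2 ^+ n.+1 :> R by rewrite exprS; lra.
have /andP[+ _] := H_phi_increment n1 n2.
have -> : (2 ^+ n.+1 - 2 ^+ n : R) = 2 ^+ n by rewrite exprS; ring.
have : (2 * phi 2)^-1 <= 2 ^+ n / phi (2 ^+ n.+1).
  rewrite ler_pdivlMr; last by apply: (class_C_gt0 phiC); lra.
  rewrite ler_pdivrMl ?mulr_gt0//.
  have : 1 <= 2 ^+ n.+1 :> R by lra.
  by move=> /(class_C_le_linear phiC); rewrite exprS; lra.
move=> h1 h2; rewrite -[n.+1%:R]natr1 mulrDl mul1r.
by apply: le_trans (lerD IH (le_trans h1 h2)) _; rewrite addrC subrK.
Qed.

Let H_phi_surj t : 0 <= t -> exists v, 1 <= v /\ H v = t.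
Proof.
move=> t0.
have p2 : 0 < 2 * phi 2 by rewrite mulr_gt0//; apply: (class_C_gt0 phiC); lra.
(* Enough dyadic blocks for their total contribution [n / (2 * phi 2)] to reach [t]. *)
pose n := (Num.truncn (t * (2 * phi 2))).+1.
have tn : t <= H (2 ^+ n).
  apply: le_trans (H_phi_dyadic n); rewrite ler_pdivlMr//.
  by apply/ltW/truncnS_gt.
have n1 : 1 <= 2 ^+ n :> R by rewrite exprn_ege1//; lra.
have [|v] := @IVT R H 1 (2 ^+ n) t n1 (@H_within_continuous _).
  by rewrite {1}/H H_phi_le1// ge_min t0/= le_max tn orbT.
by rewrite in_itv/= => /andP[v1 _] <-; exists v.
Qed.

Lemma H_phi_invP t : 0 <= t -> 1 <= H_phi_inv phi t /\ H_phi phi (H_phi_inv phi t) = t.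
Proof. by move=> /H_phi_surj; rewrite /H_phi_inv => /(xgetPex 1). Qed.

Lemma H_phi_invK v : 1 <= v -> H_phi_inv phi (H_phi phi v) = v.
Proof.
move=> v1; have [p1 e] := H_phi_invP (H_phi_ge0 v).
by have [/(H_phi_lt p1)|/(H_phi_lt v1)|//] := ltgtP (H_phi_inv phi (H_phi phi v)) v;
  rewrite e ltxx.
Qed.

(* For negative arguments [xget] returns its default value [1]. *)
Lemma H_phi_inv_le0 t : t <= 0 -> H_phi_inv phi t = 1.
Proof.
rewrite le_eqVlt => /predU1P[->|t0].
  by rewrite -(H_phi_le1 (lexx 1)) H_phi_invK.
rewrite /H_phi_inv xgetPN// => v [_ vt].
by have := H_phi_ge0 v; rewrite vt leNgt t0.
Qed.

Lemma H_phi_inv_ge1 t : 1 <= H_phi_inv phi t.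
Proof. by have [/H_phi_inv_le0->//|/ltW/H_phi_invP[]] := leP t 0. Qed.

(** [H_phi_increment] read at [psi a] and [psi b]: an integrated form of [psi' = phi \o psi] that
    remains valid at time 0. *)
Lemma H_phi_inv_increment a b : 0 <= a -> a <= b ->
  (b - a) * phi (psi a) <= psi b - psi a <= (b - a) * phi (psi b).
Proof.
move=> a0 ab; have [pa ea] := H_phi_invP a0; have [pb eb] := H_phi_invP (le_trans a0 ab).
have pab : psi a <= psi b.
  by rewrite leNgt; apply/negP => /(H_phi_lt pb); rewrite ea eb ltNge ab.
have := H_phi_increment pa pab; rewrite ea eb.
by rewrite ler_pdivrMr ?ler_pdivlMr ?(class_C_gt0 phiC)// andbC.
Qed.

Lemma H_phi_inv_nondecreasing : nondecreasing_fun (H_phi_inv phi).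
Proof.
move=> a b ab; have [a0|a0] := leP a 0; first by rewrite (H_phi_inv_le0 a0) H_phi_inv_ge1.
have /andP[h _] := H_phi_inv_increment (ltW a0) ab.
rewrite -subr_ge0; apply: le_trans h.
by rewrite mulr_ge0 ?subr_ge0// ltW// (class_C_gt0 phiC)// H_phi_inv_ge1.
Qed.

(** Time 0 is excluded: there the extension by 1 has left slope 0 and right slope [phi 1]. *)
Let is_derive_psi t : 0 < t -> is_derive t 1 psi (phi (psi t)).
Proof.
move=> t0; have [p1 e] := H_phi_invP (ltW t0).
have p1' : 1 < psi t.
  rewrite lt_neqAle p1 andbT; apply: contraTneq t0 => p.
  by rewrite -e -/psi -p H_phi_le1// ltxx.
rewrite -[phi _]invrK -{1}e; apply: is_derive_inverse.
- by near=> v; apply/H_phi_invK/ltW; near: v; exact: lt_nbhsr.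
- near=> v; apply/differentiable_continuous/derivable1_diffP.
  have v1 : 1 < v by near: v; exact: lt_nbhsr.
  by have [] := is_derive_H_phi v1.
- exact: is_derive_H_phi.
- by rewrite invr_eq0 gt_eqF// (class_C_gt0 phiC).
Unshelve. all: by end_near. Qed.

Lemma H_phi_inv_continuous : continuous (H_phi_inv phi).
Proof.
move=> t; have [t0|t0|->] := ltgtP t 0.
- rewrite /continuous_at (H_phi_inv_le0 (ltW t0)); apply: cvg_near_cst.
  by near=> u; rewrite H_phi_inv_le0//; apply/ltW; near: u; exact: lt_nbhsl.
- by apply/differentiable_continuous/derivable1_diffP; have [] := is_derive_psi t0.
(* At 0, the increment bound gives [psi u - 1 <= u * phi (psi 1)] for [0 < u < 1]. *)
have p1 : 0 < phi (psi 1) by rewrite (class_C_gt0 phiC)// H_phi_inv_ge1.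
apply/cvgrPdist_le => e e0; near=> u.
rewrite (H_phi_inv_le0 (lexx 0)) distrC ger0_norm ?subr_ge0 ?H_phi_inv_ge1//.
have [u0|u0] := leP u 0; first by rewrite H_phi_inv_le0// subrr ltW.
have u1 : u < 1 by near: u; exact: lt_nbhsl.
have /andP[_] := H_phi_inv_increment (lexx 0) (ltW u0).
rewrite /psi (H_phi_inv_le0 (lexx 0)) subr0 => /le_trans; apply.
have : u < e / phi (psi 1) by near: u; apply: lt_nbhsl; rewrite divr_gt0.
rewrite ltr_pdivlMr// => ue; apply: le_trans (ltW ue).
rewrite ler_pM2l//; apply: (class_C_nondecreasing phiC); first exact: H_phi_inv_ge1.
exact/H_phi_inv_nondecreasing/ltW.
Unshelve. all: by end_near. Qed.


(** * Logarithmic derivative of the rate and concavity of the flow *)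

Let f t := phi (psi t).

Let f_gt0 t : 0 < f t.
Proof. by rewrite (class_C_gt0 phiC)// H_phi_inv_ge1. Qed.

Let f_continuous : continuous f.
Proof.
move=> t; apply: continuous_comp; first exact: H_phi_inv_continuous.
by apply: (class_C_continuous phiC); exact: H_phi_inv_ge1.
Qed.

Let is_derive_f t : 0 < t -> is_derive t 1 f (derive1 phi (psi t) * f t).
Proof.
move=> t0; apply: is_derive1_comp; last exact: is_derive_psi.
rewrite derive1E; apply: derivableP.
by case: (phiC) => _ _ + _ _; apply; exact: H_phi_inv_ge1.
Qed.

(* Logarithmically, [ln f] has the nonincreasing derivative [phi' \o psi]. *)
Lemma rate_ratio_nonincreasing t a b : 0 <= t -> 0 <= a -> a <= b ->
  phi (psi (b + t)) / phi (psi b) <= phi (psi (a + t)) / phi (psi a).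
Proof.
move=> t0 a0 ab; rewrite -/(f _) -/(f _) -/(f _) -/(f _).
pose q x := f (x + t) * (f x)^-1; rewrite -/(q b) -/(q a).
have dq x : 0 < x -> is_derive x 1 q
    ((derive1 phi (psi (x + t)) - derive1 phi (psi x)) * q x).
  move=> x0; have xt : 0 < x + t by lra.
  have dfx := is_derive_f x0.
  have dft : is_derive x 1 (fun y => f (y + t)) (derive1 phi (psi (x + t)) * f (x + t)).
    rewrite -[X in is_derive _ _ _ X]mulr1; apply: is_derive1_comp.
      exact: is_derive_f.
    exact: is_derive_shift.
  have dV := is_deriveV (lt0r_neq0 (f_gt0 x)) dfx.
  apply: is_derive_eq (is_deriveM dft dV) _.
  rewrite /q /GRing.scale/= -exprVn.
  field; exact: lt0r_neq0.
(* The sign of the derivative is known on the open half-line only; continuity of [q] brings in the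
   endpoint 0, needed when [a = 0]. *)
apply: (@ler0_derive1_nincry R q 0) => // [x|x|].
- by rewrite in_itv/= andbT => /dq[].
- rewrite in_itv/= andbT => x0; rewrite derive1E; have [_ ->] := dq _ x0.
  rewrite mulr_le0_ge0 ?subr_le0//; last by rewrite mulr_ge0 ?invr_ge0// ltW.
  apply: (class_C_derive1_nonincreasing phiC); first exact: H_phi_inv_ge1.
  by apply: H_phi_inv_nondecreasing; rewrite lerDl.
- apply: continuous_subspaceT => x; apply: cvgM.
    apply: continuous_comp; last exact: f_continuous.
    by apply: cvgD; [exact: cvg_id|exact: cvg_cst].
  by apply: cvgV; [exact: lt0r_neq0|exact: f_continuous].
Qed.

(* The time-[t] flow map [psi a |-> psi (a + t)] of [v' = phi v] is concave. *)
Lemma flow_tangent t a b : 0 <= t -> 0 <= a -> 0 <= b ->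
  psi (b + t) - psi (a + t) <=
    phi (psi (a + t)) / phi (psi a) * (psi b - psi a).
Proof.
move=> t0 a0 b0; set c := (_ / _).
(* By the ratio lemma [D' = c * f x - f (x + t)] is nonpositive before [a] and nonnegative after it,
   so [a] minimizes [D]. *)
pose D x := c * psi x - psi (x + t).
suff : D a <= D b by rewrite /D; lra.
have dD x : 0 < x -> is_derive x 1 D (c * f x - f (x + t)).
  move=> x0; have xt : 0 < x + t by lra.
  have dpsi := is_derive_psi x0.
  have dpsit : is_derive x 1 (fun y => psi (y + t)) (f (x + t)).
    rewrite -[X in is_derive _ _ _ X]mulr1; apply: is_derive1_comp.
      exact: is_derive_psi.
    exact: is_derive_shift.
  have dc := is_deriveZ c dpsi.
  exact: (is_deriveB dc dpsit).
have cD : continuous D.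
  move=> x; apply: cvgB.
    by apply: cvgM; [exact: cvg_cst|exact: H_phi_inv_continuous].
  apply: continuous_comp; last exact: H_phi_inv_continuous.
  by apply: cvgD; [exact: cvg_id|exact: cvg_cst].
have [ab|/ltW ba] := leP a b.
  apply: (@ger0_derive1_ndecry R D a) => // [x|x|].
  - by rewrite in_itv/= andbT => /(le_lt_trans a0)/dD[].
  - rewrite in_itv/= andbT => ax; have x0 := le_lt_trans a0 ax.
    rewrite derive1E; have [_ ->] := dD _ x0.
    rewrite subr_ge0 -ler_pdivrMr ?f_gt0//.
    exact/rate_ratio_nonincreasing/ltW.
  - exact: continuous_subspaceT.
apply: (@ler0_derive1_nincr R D 0 a) => // [x|x|].
- by rewrite in_itv/= => /andP[/dD[]].
- rewrite in_itv/= => /andP[x0 xa]; rewrite derive1E; have [_ ->] := dD _ x0.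
  rewrite subr_le0 -ler_pdivlMr ?f_gt0//.
  exact: rate_ratio_nonincreasing t0 (ltW x0) (ltW xa).
- exact: continuous_subspaceT.
Qed.

End rate_flow.

(** * The rate function *)

Section rate_drift.
Context {R : realType} {phi : R -> R} (phiC : in_class_C phi).
Implicit Types (v y : R) (n k : nat).

Lemma r_phiE n : r_phi phi n = phi (H_phi_inv phi n%:R) / phi 1.
Proof. by rewrite /r_phi (@H_phi_inv_le0 _ _ phiC 0). Qed.

Lemma r_phi_gt0 n : 0 < r_phi phi n.
Proof. by rewrite r_phiE divr_gt0// (class_C_gt0 phiC)// (H_phi_inv_ge1 phiC). Qed.

Lemma r_phi0 : r_phi phi 0 = 1.
Proof. by rewrite /r_phi divff// gt_eqF// (class_C_gt0 phiC)// (H_phi_inv_ge1 phiC). Qed.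

(** The ratio of consecutive rates is nonincreasing in [n], hence at most its value [r_phi phi 1] at
    0. This is where the factor [r_phi phi 1] in the bound on [U0] comes from. *)
Lemma r_phiS n : r_phi phi n.+1 <= r_phi phi 1 * r_phi phi n.
Proof.
have := rate_ratio_nonincreasing phiC (ler0n R n) (lexx 0) ler01.
rewrite add0r (@H_phi_inv_le0 _ _ phiC 0)// -r_phiE.
rewrite ler_pdivrMr ?(class_C_gt0 phiC) ?(H_phi_inv_ge1 phiC)// => h.
rewrite !(r_phiE 1, r_phiE n.+1) mulrAC ler_pM2r ?invr_gt0 ?(class_C_gt0 phiC)//.
by rewrite -natr1 addrC mulrC.
Qed.

(* The integral of [r_phi (z + k)] over [z] in [0, H_phi v], since [psi' = phi \o psi]
   for [psi := H_phi_inv phi]. *)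
Definition rate_potential (phi : R -> R) k v : R :=
  (H_phi_inv phi (H_phi phi v + k%:R) - H_phi_inv phi k%:R) / phi 1.

Lemma rate_potential_nondecreasing k : nondecreasing_fun (rate_potential phi k).
Proof.
move=> v y vy; rewrite ler_pM2r ?invr_gt0 ?(class_C_gt0 phiC)// lerB//.
by apply: (H_phi_inv_nondecreasing phiC); rewrite lerD2r; exact: (H_phi_nondecreasing phiC).
Qed.

Lemma rate_potential_ge0 k v : 0 <= rate_potential phi k v.
Proof.
rewrite divr_ge0 ?subr_ge0//; last by rewrite ltW// (class_C_gt0 phiC).
by apply: (H_phi_inv_nondecreasing phiC); rewrite lerDr (H_phi_ge0 phiC).
Qed.

Lemma rate_potential0 v : 1 <= v -> rate_potential phi 0 v = (v - 1) / phi 1.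
Proof. by move=> v1; rewrite /rate_potential addr0 (H_phi_invK phiC)// (H_phi_inv_le0 phiC). Qed.

(* Tangent line of the concave [rate_potential phi k.+1] at [v], with the
   intercept estimated along the flow; integrating in [y] gives the drift inequality. *)
Lemma rate_potential_drift k v : 1 <= v -> exists2 c, 0 <= c & forall y, 1 <= y ->
  rate_potential phi k.+1 y + c * v + r_phi phi k <=
  rate_potential phi k v + c * (y + phi v).
Proof.
move=> v1; have p1 : 0 < phi 1 by rewrite (class_C_gt0 phiC).
have pv : 0 < phi v by rewrite (class_C_gt0 phiC).
have Hv := H_phi_ge0 phiC v.
have k0 : 0 <= k%:R :> R by [].
set a := H_phi phi v in Hv *.
have pvk : 0 < phi (H_phi_inv phi (a + k.+1%:R)).
  by rewrite (class_C_gt0 phiC)// (H_phi_inv_ge1 phiC).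
(* The slope at [v] of [rate_potential phi k.+1], by the chain rule. *)
exists (phi (H_phi_inv phi (a + k.+1%:R)) / phi v / phi 1) => [|y y1].
  by rewrite !divr_ge0// ltW.
have := flow_tangent phiC (ler0n R k.+1) Hv (H_phi_ge0 phiC y).
rewrite !(H_phi_invK phiC)// => tangent.
have kS : k%:R <= k.+1%:R :> R by rewrite ler_nat.
have akS : a + k%:R <= a + k.+1%:R by rewrite lerD2l.
(* Over one unit of time the flow started at [v] gains at most its final speed, which is the slope
   times [phi v] up to the factor [phi 1]; the flow started at 1 gains at least its initial speed,
   [phi 1 * r_phi phi k]. *)
have /andP[_ up] := H_phi_inv_increment phiC (addr_ge0 Hv k0) akS.
have /andP[low _] := H_phi_inv_increment phiC k0 kS.
have s1 : k.+1%:R - k%:R = 1 :> R by rewrite -natr1; ring.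
have s2 : a + k.+1%:R - (a + k%:R) = 1 :> R by rewrite -natr1; ring.
rewrite s1 mul1r in low; rewrite s2 mul1r in up.
rewrite r_phiE /rate_potential -/a -(ler_pM2r p1).
set A := H_phi_inv phi (H_phi phi y + k.+1%:R) in tangent *.
set c := _ / phi v in tangent *.
have cv : c * phi v = phi (H_phi_inv phi (a + k.+1%:R)) by rewrite mulfVK// gt_eqF.
have -> : ((A - H_phi_inv phi k.+1%:R) / phi 1 + c / phi 1 * v +
    phi (H_phi_inv phi k%:R) / phi 1) * phi 1 =
  A - H_phi_inv phi k.+1%:R + c * v + phi (H_phi_inv phi k%:R) by field; exact: lt0r_neq0.
have -> : ((H_phi_inv phi (a + k%:R) - H_phi_inv phi k%:R) / phi 1 + c / phi 1 * (y + phi v)) * phi 1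
   = H_phi_inv phi (a + k%:R) - H_phi_inv phi k%:R + c * y + c * phi v.
  by field; exact: lt0r_neq0.
rewrite cv; lra.
Qed.

End rate_drift.

(** * Killed iterates and residual kernel *)

Local Open Scope ereal_scope.

(** Keeping [a] on the left makes all integrands nonnegative, so additivity needs no integrability
    of [f]; [a] is subtracted only after integration. *)
Lemma integral_le_affine d (T : measurableType d) (R : realType)
    (mu : {measure set T -> \bar R}) (f : T -> \bar R) (W : T -> R) (a b c w : R) :
  mu setT = 1 -> (forall y, 0 <= f y) -> measurable_fun setT f ->
  (forall y, 0 <= W y)%R -> measurable_fun setT W ->
  (0 <= a)%R -> (0 <= b)%R -> (0 <= c)%R ->
  (forall y, f y + a%:E <= (b + c * W y)%:E) ->
  \int[mu]_y (W y)%:E <= w%:E ->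
  \int[mu]_y f y <= (b + c * w - a)%:E.
Proof.
move=> mu1 f0 mf W0 mW a0 b0 c0 fW Ww.
have mW' : measurable_fun setT (EFin \o W) by exact/measurable_EFinP.
have : \int[mu]_y (f y + a%:E) <= \int[mu]_y (b%:E + c%:E * (W y)%:E).
  apply: ge0_le_integral => //.
  - by move=> y _; rewrite adde_ge0// lee_fin.
  - exact: emeasurable_funD.
  - by apply: emeasurable_funD => //; exact: measurable_funeM.
have cW0 y : setT y -> 0 <= c%:E * (W y)%:E by move=> _; rewrite mule_ge0 ?lee_fin.
have mcW : measurable_fun setT (fun y => c%:E * (W y)%:E) by exact: measurable_funeM.
have a0' y : (setT : set T) y -> 0 <= a%:E by rewrite lee_fin.
have b0' y : (setT : set T) y -> 0 <= b%:E by rewrite lee_fin.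
rewrite (ge0_integralD _ measurableT (fun y _ => f0 y) mf a0')//.
rewrite (ge0_integralD _ measurableT b0' _ cW0)//.
rewrite !integral_cst//= ge0_integralZl_EFin//; last by move=> y _; rewrite lee_fin.
rewrite mu1 !mule1 -leeBrDr// => /le_trans; apply.
by rewrite EFinB EFinD EFinM leeB// leeD// lee_wpmul2l// lee_fin.
Qed.

Section killed_iterates.
Context d (T : measurableType d) (R : realType) (P : R.-pker T ~> T) (C : set T).
Hypothesis mC : measurable C.
Implicit Types (g : T -> \bar R) (x : T).

Lemma killed_iter_ge0 g k x : (forall y, 0 <= g y) -> 0 <= killed_iter P C g k x.
Proof.
move=> g0; elim: k x => [//|k IH] x /=.
by rewrite mule_ge0 ?lee_fin ?indicE//; exact: integral_ge0.
Qed.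

Lemma measurable_killed_iter g k : (forall y, 0 <= g y) -> measurable_fun setT g ->
  measurable_fun setT (killed_iter P C g k).
Proof.
move=> g0 mg; elim: k => [//|k IH] /=.
apply: emeasurable_funM.
  by apply/measurable_EFinP/measurable_indic; exact: measurableC.
apply: (measurable_fun_integral_kernel (l := P)) => //; first by move=> U; exact: measurable_kernel.
by move=> z; exact: killed_iter_ge0.
Qed.

(** Dynamic programming: [F k] is a supersolution for the cost still to be paid from time [k] until
    [C] is reached. *)
Lemma killed_iter_comparison g (w : nat -> R) (F : nat -> T -> \bar R) :
  (forall y, 0 <= g y) -> measurable_fun setT g -> (forall k, 0 <= w k)%R ->
  (forall k y, 0 <= F k y) -> (forall k, measurable_fun setT (F k)) ->
  (forall k x, C x -> (w k)%:E * g x <= F k x) ->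
  (forall k x, ~ C x -> (w k)%:E * g x + \int[P x]_y F k.+1 y <= F k x) ->
  forall x, \sum_(0 <= k <oo) (w k)%:E * killed_iter P C g k x <= F 0%N x.
Proof.
move=> g0 mg w0 F0 mF FC FnC.
have K0 k x := @killed_iter_ge0 g k x g0.
have mK k := measurable_killed_iter k g0 mg.
have wK0 j k x : 0 <= (w j)%:E * killed_iter P C g k x by rewrite mule_ge0 ?lee_fin.
have wKm j k : measurable_fun setT (fun x => (w j)%:E * killed_iter P C g k x).
  exact: measurable_funeM.
(* The weights are shifted by [j] because after one step the remaining sum starts at time
   [j + 1]. *)
suff partial n j x : \sum_(0 <= k < n) (w (j + k)%N)%:E * killed_iter P C g k x <= F j x.
  move=> x; apply: lime_le; first exact: is_cvg_nneseries.
  by apply: nearW => n; exact: (partial n 0%N).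
elim: n j x => [|n IH] j x; first by rewrite big_nil.
rewrite big_nat_recl// addn0 /=.
have [Cx|nCx] := pselect (C x).
  (* On [C] every iterate of positive order is killed, so only the term [k = 0] survives. *)
  rewrite big1 ?adde0; first exact: FC.
  by move=> k _; rewrite indicE in_setC mem_set//= mul0e mule0.
apply: le_trans (FnC j x nCx); rewrite leeD2l//.
(* Off [C] the tail is the integral of the shifted partial sum, which the induction hypothesis
   bounds by [F j.+1]. *)
rewrite indicE in_setC memNset//=.
under eq_bigr do rewrite mul1e -ge0_integralZl_EFin//.
rewrite -ge0_integral_sum//.
apply: ge0_le_integral => //.
- by move=> y _; apply: sume_ge0 => k _.
- exact: emeasurable_sum.
- by move=> y _; have := IH j.+1 y; under eq_bigr do rewrite addSnnS.
Qed.

End killed_iterates.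

(** * Splitting a minorized law into its residual and minorizing parts *)

Section residual_kernel.
Context d (T : measurableType d) (R : realType).
Variables (m : {measure set T -> \bar R}) (nu q : probability T R) (eps : R).
Hypothesis m1 : m setT = 1.
Hypothesis eps0 : (0 < eps)%R.
Hypothesis minor : forall A, measurable A -> eps%:E * nu A <= m A.
Hypothesis resid : forall A, measurable A ->
  ((eps < 1)%R -> q A = ((1 - eps)^-1)%R%:E * (m A - eps%:E * nu A)) /\
  (eps = 1%R -> q A = nu A).

Lemma minorization_le1 : (eps <= 1)%R.
Proof. by have := minor measurableT; rewrite m1 probability_setT mule1 lee_fin. Qed.

Let m_le1 A : measurable A -> m A <= 1.
Proof. by move=> mA; rewrite -m1; apply: le_measure; rewrite ?inE. Qed.

Lemma mixture_measure A : measurable A -> m A = (1 - eps)%:E * q A + eps%:E * nu A.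
Proof.
move=> mA; have := minorization_le1; rewrite le_eqVlt => /predU1P[e1|e1].
  (* For [eps = 1], [m] dominates [nu] on [A] and on its complement; both have total mass 1, so they
     agree. *)
  rewrite e1 subrr mul0e add0e mul1e; apply/eqP; rewrite eq_le.
  have := minor mA; rewrite e1 mul1e => ->; rewrite andbT.
  have := minor (measurableC mA); rewrite e1 mul1e probability_setC//.
  have : m setT = m (setT `\` A) + m (setT `&` A) := measureDI m measurableT mA.
  rewrite setTD setTI m1.
  have := measure_ge0 m A; have := measure_ge0 m (~` A).
  rewrite -(fineK (fin_num_measure nu _ mA)).
  case: (m (~` A)) => [a||]//; case: (m A) => [b||]// _ _ [e].
  by rewrite -EFinB !lee_fin; lra.
have mAfin : m A \is a fin_num.
  by rewrite ge0_fin_numE// (le_lt_trans (m_le1 mA))// ltry.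
rewrite ((resid mA).1 e1) muleA -EFinM divff ?mul1e; last by rewrite subr_eq0 gt_eqF.
by rewrite subeK//; apply: fin_numM => //; exact: fin_num_measure.
Qed.

Lemma mixture_integral (f : T -> \bar R) : (forall y, 0 <= f y) -> measurable_fun setT f ->
  \int[m]_y f y = (1 - eps)%:E * \int[q]_y f y + eps%:E * \int[nu]_y f y.
Proof.
move=> f0 mf; have e1 : (0 <= 1 - eps)%R by rewrite subr_ge0 minorization_le1.
rewrite -(ge0_integral_mscale q measurableT (NngNum e1))//.
rewrite -(ge0_integral_mscale nu measurableT (NngNum (ltW eps0)))//.
rewrite -ge0_integral_measure_add//; apply: eq_measure_integral => A mA _.
rewrite [RHS]measure_addE; exact: mixture_measure.
Qed.

End residual_kernel.

(** * Drift bounds *)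

Section drift_bounds.
Context d (T : measurableType d) (R : realType) (P : R.-pker T ~> T) (C : set T).
Context (W : T -> R) (phi : R -> R).
Hypotheses (mC : measurable C) (mW : measurable_fun setT W) (W1 : forall x, (1 <= W x)%R).
Hypotheses (phiC : in_class_C phi)
  (drift : forall x, ~ C x -> \int[P x]_y (W y)%:E <= (W x - phi (W x))%:E).

Let W_ge0 y : (0 <= W y)%R.
Proof. by apply: le_trans (W1 y). Qed.

Let phiW_gt0 x : (0 < phi (W x))%R.
Proof. exact: (class_C_gt0 phiC). Qed.

Let measurable_fun_EFin (f : T -> R) :
  measurable_fun setT f -> measurable_fun setT (fun y => (f y)%:E).
Proof. by move/measurable_EFinP. Qed.

Lemma measurable_class_C_comp : measurable_fun setT (phi \o W).
Proof.
(* [phi] is controlled only on [[1, +oo)]; truncating its argument gives a globally monotone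
   function with the same composite. *)
pose f (v : R) := phi (Num.max 1%R v).
have -> : phi \o W = f \o W by apply/funext => y; rewrite /f /= max_r.
apply: measurableT_comp => //; apply: nondecreasing_measurable => // v w vw.
apply: (class_C_nondecreasing phiC); first by rewrite le_max lexx.
by rewrite ge_max !le_max lexx vw orbT.
Qed.

Let measurable_potential k : measurable_fun setT (rate_potential phi k \o W).
Proof.
apply: measurableT_comp => //; apply: nondecreasing_measurable => //.
exact: rate_potential_nondecreasing.
Qed.

Let measurable_indC : measurable_fun setT (\1_(~` C) : T -> R).
Proof. by apply: measurable_indic; exact: measurableC. Qed.

Let indC_in x : C x -> \1_(~` C) x = 0%R :> R.
Proof. by move=> Cx; rewrite indicE in_setC mem_set. Qed.

Let indC_out x : ~ C x -> \1_(~` C) x = 1%R :> R.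
Proof. by move=> nCx; rewrite indicE in_setC memNset. Qed.

Let indC_itv x : (0 <= (\1_(~` C) x : R) <= 1)%R.
Proof. by have [/indC_in|/indC_out] := pselect (C x) => ->; rewrite !lexx ler01. Qed.

Let mulr_indC_ge0 (u : R) x : (0 <= u)%R -> (0 <= u * \1_(~` C) x)%R.
Proof. by move=> u0; have /andP[] := indC_itv x => *; rewrite mulr_ge0. Qed.

Let mulr_indC_le (u : R) x : (0 <= u)%R -> (u * \1_(~` C) x <= u)%R.
Proof. by move=> u0; have /andP[] := indC_itv x => *; rewrite ler_piMr. Qed.

Lemma integral_rate_potential k x : ~ C x ->
  \int[P x]_y (rate_potential phi k.+1 (W y))%:E <=
  (rate_potential phi k (W x) - r_phi phi k)%:E.
Proof.
move=> nCx; have [c c0 hc] := rate_potential_drift phiC k (W1 x).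
have phiW0 := ltW (phiW_gt0 x); have r0 := ltW (r_phi_gt0 phiC k).
have pot0 := rate_potential_ge0 phiC.
(* Integrating the tangent line of slope [c] and inserting the drift of [W], all terms in [c]
   cancel. *)
apply: (@le_trans _ _ (rate_potential phi k (W x) + c * phi (W x) +
  c * (W x - phi (W x)) - (c * W x + r_phi phi k))%:E); last by rewrite lee_fin; lra.
apply: (@integral_le_affine _ _ _ _ _ W) => //.
- exact: prob_kernel.
- by move=> y; rewrite lee_fin.
- exact/measurable_fun_EFin/measurable_potential.
- by rewrite addr_ge0// mulr_ge0.
- by rewrite addr_ge0// mulr_ge0.
- by move=> y; rewrite -EFinD lee_fin; have := hc _ (W1 y); lra.
- exact: drift.
Qed.

Lemma U0_le x : U0 P C (r_phi phi) x <=
  (1 + r_phi phi 1 / phi 1 * (W x - 1) * \1_(~` C) x)%:E.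
Proof.
have r0 k := ltW (r_phi_gt0 phiC k).
have pot0 := rate_potential_ge0 phiC.
(* The term [r_phi phi k] pays the current step. Off [C], the next one costs [r_phi phi k.+1 <=
   r_phi phi 1 * r_phi phi k], which is exactly covered by the decrease of the potential times
   [r_phi phi 1]. *)
pose F k y := (r_phi phi k + r_phi phi 1 * (rate_potential phi k (W y) * \1_(~` C) y))%R.
have F0 k y : (0 <= F k y)%R by rewrite addr_ge0// mulr_ge0// mulr_indC_ge0.
have mF k : measurable_fun setT (F k).
  apply: measurable_funD => //; apply: measurable_funM => //.
  by apply: measurable_funM => //; exact: measurable_potential.
have -> : (1 + r_phi phi 1 / phi 1 * (W x - 1) * \1_(~` C) x)%R = F 0%N x.
  by rewrite /F (r_phi0 phiC) rate_potential0//; congr (_ + _)%R; ring.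
apply: (@killed_iter_comparison _ _ _ _ _ mC (cst 1) _ (fun k y => (F k y)%:E)) => //.
- by move=> k; exact/measurable_fun_EFin.
- by move=> k y Cy; rewrite mule1 lee_fin lerDl mulr_ge0// mulr_indC_ge0.
- move=> k y nCy; rewrite mule1 /F (indC_out nCy) mulr1 EFinD leeD2l//.
  have := @integral_le_affine _ _ _ (P y) (fun z => (F k.+1 z)%:E)
    (fun z => rate_potential phi k.+1 (W z)) 0 (r_phi phi k.+1) (r_phi phi 1)
    (rate_potential phi k (W y) - r_phi phi k) (prob_kernel _).
  move=> /(_ (F0 k.+1)) h; apply: le_trans (h _ _ _ _ _ _ _ _) _ => //.
  + exact/measurable_fun_EFin.
  + exact: measurable_potential.
  + by move=> z; rewrite adde0 lee_fin lerD2l ler_wpM2l// mulr_indC_le.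
  + exact: integral_rate_potential.
  + by rewrite lee_fin; have := r_phiS phiC k; lra.
Qed.

Let V0_comparison (F : T -> R) :
  (forall y, 0 <= F y)%R -> measurable_fun setT F ->
  (forall y, C y -> phi (W y) <= F y)%R ->
  (forall y, ~ C y -> (phi (W y))%:E + \int[P y]_z (F z)%:E <= (F y)%:E) ->
  forall x, V0 P C (phi \o W) x <= (F x)%:E.
Proof.
move=> F0 mF FC FnC x; rewrite /V0.
under eq_eseriesr do rewrite -[killed_iter _ _ _ _ _]mul1e.
apply: (@killed_iter_comparison _ _ _ _ _ mC (fun y => (phi (W y))%:E)
  (fun _ => 1%R) (fun _ y => (F y)%:E)) => //.
- by move=> y; rewrite lee_fin ltW.
- exact/measurable_fun_EFin/measurable_class_C_comp.
- by move=> _; exact/measurable_fun_EFin.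
- by move=> k y Cy; rewrite mul1e lee_fin FC.
- by move=> k y nCy; rewrite mul1e FnC.
Qed.

(** [S] pays for the arrival in [C], and the drift of [W] for the visits before it. *)
Lemma V0_le (S : R) x : (forall y, C y -> phi (W y) <= S)%R -> (0 <= S)%R ->
  V0 P C (phi \o W) x <= (S + W x * \1_(~` C) x)%:E.
Proof.
move=> SC S0; move: x; apply: V0_comparison.
- by move=> y; rewrite addr_ge0// mulr_indC_ge0.
- by apply: measurable_funD => //; exact: measurable_funM.
- by move=> y Cy; rewrite indC_in// mulr0 addr0 SC.
- move=> y nCy; rewrite (indC_out nCy) mulr1.
  have h : \int[P y]_z (S + W z * \1_(~` C) z)%:E <= (S + 1 * (W y - phi (W y)) - 0)%:E.
    apply: (@integral_le_affine _ _ _ _ _ W) => //.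
    + exact: prob_kernel.
    + by move=> z; rewrite lee_fin addr_ge0// mulr_indC_ge0.
    + by apply/measurable_fun_EFin/measurable_funD => //; exact: measurable_funM.
    + by move=> z; rewrite adde0 lee_fin mul1r lerD2l mulr_indC_le.
    + exact: drift.
  apply: le_trans (leeD2l _ h) _; rewrite -EFinD lee_fin; lra.
Qed.

(* Gives finiteness of [V0] also when [phi \o W] is unbounded on [C]. *)
Lemma V0_le_linear x : V0 P C (phi \o W) x <= (Num.max 1 (phi 2) * W x)%:E.
Proof.
(* [K >= phi 2] gives the domination on [C]; [K >= 1] lets the drift of [K * W] absorb [phi \o W]
   off [C]. *)
set K := Num.max 1%R (phi 2).
have K1 : (1 <= K)%R by rewrite le_max lexx.
have K0 : (0 <= K)%R by apply: le_trans K1.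
move: x; apply: V0_comparison.
- by move=> y; rewrite mulr_ge0.
- exact: measurable_funM.
- move=> y _; apply: le_trans (class_C_le_linear phiC (W1 y)) _.
  by rewrite ler_wpM2r// le_max lexx orbT.
- move=> y nCy.
  have h : \int[P y]_z (K * W z)%:E <= (0 + K * (W y - phi (W y)) - 0)%:E.
    apply: (@integral_le_affine _ _ _ _ _ W) => //.
    + exact: prob_kernel.
    + by move=> z; rewrite lee_fin mulr_ge0.
    + by apply/measurable_fun_EFin; exact: measurable_funM.
    + by move=> z; rewrite adde0 add0r.
    + exact: drift.
  apply: le_trans (leeD2l _ h) _; rewrite -EFinD lee_fin.
  have : (phi (W y) <= K * phi (W y))%R by rewrite ler_peMl// ltW.
  lra.
Qed.

Lemma U0_ge0 x : 0 <= U0 P C (r_phi phi) x.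
Proof.
apply: nneseries_ge0 => k _ _; rewrite mule_ge0// ?killed_iter_ge0//.
by rewrite lee_fin ltW// (r_phi_gt0 phiC).
Qed.

Lemma V0_ge0 x : 0 <= V0 P C (phi \o W) x.
Proof. by apply: nneseries_ge0 => k _ _; apply: killed_iter_ge0 => y; exact: (ltW (phiW_gt0 y)). Qed.

Lemma measurable_U0 : measurable_fun setT (U0 P C (r_phi phi)).
Proof.
apply: ge0_emeasurable_sum => [k x _ _|k _].
  by rewrite mule_ge0// ?killed_iter_ge0// lee_fin ltW// (r_phi_gt0 phiC).
by apply: measurable_funeM; exact: measurable_killed_iter.
Qed.

Lemma measurable_V0 : measurable_fun setT (V0 P C (phi \o W)).
Proof.
have phiW0 y : 0 <= (phi (W y))%:E by rewrite lee_fin ltW.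
apply: ge0_emeasurable_sum => [k x _ _|k _]; first exact: killed_iter_ge0.
apply: measurable_killed_iter => //; exact/measurable_fun_EFin/measurable_class_C_comp.
Qed.

End drift_bounds.

(** * Finiteness and bounds over [C] through the residual kernel *)

Theorem theorem5 (d : measure_display) (T : measurableType d) (R : realType)
  (le : T -> T -> Prop)
  (le_refl : forall x, le x x)
  (le_anti : forall x y, le x y -> le y x -> x = y)
  (le_trans : forall x y z, le x y -> le y z -> le x z)
  (le_total : forall x y, le x y \/ le y x)
  (ray_meas : forall a, measurable [set y | le y a])
  (P : R.-pker T ~> T)
  (P_mono : forall a x y, le x y ->
     P y [set z | le z a] <= P x [set z | le z a])
  (x0 : T) (eps : R) (nu : probability T R)
  (Q : T -> probability T R)
  (W0 : T -> R) (phi : R -> R) :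
  let C := [set x | le x x0] in
  (0 < eps)%R ->
  (forall x, C x -> forall A, measurable A -> eps%:E * nu A <= P x A) ->
  (forall x, C x -> forall A, measurable A ->
      ((eps < 1)%R -> Q x A = ((1 - eps)^-1)%R%:E * (P x A - eps%:E * nu A)) /\
      (eps = 1%R -> Q x A = nu A)) ->
  measurable_fun setT W0 ->
  (forall x, (1 <= W0 x)%R) ->
  in_class_C phi ->
  (forall x, ~ C x -> \int[P x]_y (W0 y)%:E <= (W0 x - phi (W0 x))%R%:E) ->
  ereal_sup [set \int[P x]_y (W0 y)%:E | x in C] < +oo ->
  let r := r_phi phi in
  let v0 := fun x => phi (W0 x) in
  let U := U0 P C r in
  let V := V0 P C v0 in
  let bU := ereal_sup [set \int[Q x]_y U y | x in C] in
  let bV := ereal_sup [set \int[Q x]_y V y | x in C] in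
  let supPW := ereal_sup [set \int[P x]_y (W0 y)%:E | x in C] in
  let supv0 := ereal_sup [set (v0 y)%:E | y in C] in
  let B := if (eps < 1)%R
           then ((1 - eps)^-1)%R%:E * (supPW - eps%:E * \int[nu]_y (W0 y)%:E)
           else \int[nu]_y (W0 y)%:E in
  [/\ (forall x, U x < +oo), (forall x, V x < +oo), bU < +oo & bV < +oo] /\
  [/\ (forall x, U x <= (1 + r 1%N / phi 1 * (W0 x - 1) * \1_(~` C) x)%R%:E),
      (forall x, V x <= supv0 + (W0 x * \1_(~` C) x)%R%:E),
      bU <= 1 + (r 1%N / phi 1)%R%:E * (B - 1) &
      bV <= supv0 + B].
Proof.
move=> C eps_gt0 minor resid mW W1 phiC drift supPW_fin r v0 U V bU bV supPW supv0 B.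
have mC : measurable C := ray_meas x0.
have Cx0 : C x0 := le_refl x0.
have W_ge0 y : (0 <= W0 y)%R by apply: Order.POrderTheory.le_trans (W1 y).
have EW_ge0 y : 0 <= (W0 y)%:E by rewrite lee_fin.
have mEW : measurable_fun setT (fun y => (W0 y)%:E) by exact/measurable_EFinP.
have Px1 x : P x setT = 1 := prob_kernel x.
have phi1_gt0 : (0 < phi 1)%R by exact: (class_C_gt0 phiC).
have v0_ge0 x : (0 <= v0 x)%R by rewrite ltW// (class_C_gt0 phiC).
pose c := (r 1%N / phi 1)%R.
have c_ge0 : (0 <= c)%R by rewrite divr_ge0 ?ltW// (r_phi_gt0 phiC).
pose K := (Num.max 1 (phi 2))%R.
have U_le x : U x <= (1 + c * (W0 x - 1) * \1_(~` C) x)%R%:E := U0_le mC mW W1 phiC drift x.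
have V_leK x : V x <= (K * W0 x)%:E := V0_le_linear mC mW W1 phiC drift x.
(* Affine majorant of [U] without the indicator, in the form that [integral_le_affine]
   integrates. *)
have U_le' x : U x + c%:E <= (1 + c * W0 x)%:E.
  rewrite -leeBrDr// -EFinB; apply: Order.POrderTheory.le_trans (U_le x) _.
  have h : (0 <= c * (W0 x - 1))%R by rewrite mulr_ge0// subr_ge0.
  rewrite lee_fin indicE; case: (_ \in _) => /=; lra.
have PW_le x : C x -> \int[P x]_y (W0 y)%:E <= supPW.
  by move=> Cx; apply: ereal_sup_ubound; exists x.
have supPW_real : supPW \is a fin_num.
  rewrite ge0_fin_numE//; apply: Order.POrderTheory.le_trans (PW_le x0 Cx0).
  exact: integral_ge0.
have mix x (Cx : C x) := mixture_integral (Px1 x) eps_gt0 (minor x Cx) (resid x Cx) EW_ge0 mEW.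
have eps_le1 := minorization_le1 (Px1 x0) (minor x0 Cx0).
(* By minorization, [eps] times this integral is at most [supPW], which is finite. *)
have nuW_real : \int[nu]_y (W0 y)%:E \is a fin_num.
  rewrite ge0_fin_numE ?integral_ge0//.
  have : eps%:E * \int[nu]_y (W0 y)%:E < +oo.
    apply: le_lt_trans supPW_fin; apply: Order.POrderTheory.le_trans (PW_le x0 Cx0).
    by rewrite (mix x0 Cx0) leeDr// mule_ge0 ?lee_fin ?subr_ge0// integral_ge0.
  by case: (integral _ _ _) => [u||]; rewrite ?gt0_muley ?lte_fin ?ltry ?ltNyy.
(* For [eps < 1], solve the mixture identity for the [Q x] integral; for [eps = 1], [Q x] is
   [nu]. *)
have [b Bb QW_le] : exists2 b, B = b%:E &
    forall x, C x -> \int[Q x]_y (W0 y)%:E <= b%:E.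
  rewrite /B; case: ifPn => [eps_lt1|]; last first.
    rewrite -leNgt => eps_ge1; have eps1 : eps = 1%R by apply/eqP; rewrite eq_le eps_le1.
    exists (fine (\int[nu]_y (W0 y)%:E)); rewrite ?fineK// => x Cx.
    rewrite (eq_measure_integral nu)// => A mA _; exact: (resid x Cx A mA).2.
  have e1 : (0 < 1 - eps)%R by rewrite subr_gt0.
  exists ((1 - eps)^-1 * (fine supPW - eps * fine (\int[nu]_y (W0 y)%:E)))%R.
    by rewrite EFinM EFinB EFinM !fineK.
  move=> x Cx; rewrite EFinM lee_pdivlMl// [leRHS]EFinB EFinM !fineK// leeBrDr; last first.
    by rewrite fin_numM.
  by rewrite -(mix x Cx); exact: PW_le.
have Q1 x : Q x setT = 1 := probability_setT (Q x).
have QU_le x : C x -> \int[Q x]_y U y <= (1 + c * b - c)%:E.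
  move=> Cx; apply: (@integral_le_affine _ _ _ _ U W0) => //.
  - exact: Q1.
  - exact: (U0_ge0 P C phiC).
  - exact: (measurable_U0 P mC phiC).
  - exact: QW_le.
(* Finiteness of [bV] uses the linear bound, since [supv0] may be infinite. *)
have QV_leK x : C x -> \int[Q x]_y V y <= (0 + K * b - 0)%:E.
  move=> Cx; apply: (@integral_le_affine _ _ _ _ V W0) => //.
  - exact: Q1.
  - exact: (V0_ge0 P C W1 phiC).
  - exact: (measurable_V0 P mC mW W1 phiC).
  - by rewrite le_max ler01.
  - by move=> y; rewrite adde0 add0r.
  - exact: QW_le.
have bU_le : bU <= (1 + c * b - c)%:E by apply: ge_ereal_sup => _ [x Cx <-]; exact: QU_le.
have bV_leK : bV <= (0 + K * b - 0)%:E by apply: ge_ereal_sup => _ [x Cx <-]; exact: QV_leK.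
have supv0_ub y : C y -> (v0 y)%:E <= supv0 by move=> Cy; apply: ereal_sup_ubound; exists y.
split; split => //.
- by move=> x; apply: le_lt_trans (U_le x) (ltry _).
- by move=> x; apply: le_lt_trans (V_leK x) (ltry _).
- exact: le_lt_trans bU_le (ltry _).
- exact: le_lt_trans bV_leK (ltry _).
(* If [supv0] is [+oo] the bound is trivial; [-oo] is excluded because [x0] lies in [C]. *)
- move=> x; move: supv0_ub; case: supv0 => [S||] ub.
  + rewrite -EFinD; apply: (V0_le mC mW W1 phiC drift) => //.
    by rewrite -lee_fin; apply: Order.POrderTheory.le_trans (ub x0 Cx0); rewrite lee_fin.
  + by rewrite addye// leey.
  + by have := ub x0 Cx0.
- by rewrite Bb -EFinB -EFinM -EFinD; apply: Order.POrderTheory.le_trans bU_le _; rewrite lee_fin -/c; lra.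
- rewrite Bb; move: supv0_ub; case: supv0 => [S||] ub.
  + have S0 : (0 <= S)%R.
      by rewrite -lee_fin; apply: Order.POrderTheory.le_trans (ub x0 Cx0); rewrite lee_fin.
    apply: ge_ereal_sup => _ [x Cx <-]; rewrite -EFinD.
    apply: (@Order.POrderTheory.le_trans _ _ (S + 1 * b - 0)%:E); last by rewrite lee_fin; lra.
    apply: (@integral_le_affine _ _ _ _ V W0) => //.
    * exact: Q1.
    * exact: (V0_ge0 P C W1 phiC).
    * exact: (measurable_V0 P mC mW W1 phiC).
    * move=> y; rewrite adde0 mul1r; apply: Order.POrderTheory.le_trans (V0_le mC mW W1 phiC drift y _ S0) _ => //.
      rewrite lee_fin lerD2l indicE; case: (_ \in _) => /=; rewrite ?mulr1 ?mulr0//.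
    * exact: QW_le.
  + by rewrite addye// leey.
  + by have := ub x0 Cx0.
Qed.
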